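(* Let $F$ be a field and let $X$ be a nonempty set of rank one valuation rings in $\operatorname{Zar}(F)$. Then $A(X)$ is a Prüfer $G$-domain with quotient field $F$ if and only if $J(X)\neq 0$ and $A(\lim X)$ is a Prüfer $G$-domain with quotient field $F$.
   Context: A valuation ring of the field $F$ is a subring $V$ of $F$ such that for each $0\ne t\in F$, $t\in V$ or $t^{-1}\in V$ (so $F$ itself is one); $\mathfrak M_V$ denotes its maximal ideal, and $\operatorname{Zar}(F)$ is the set of all valuation rings of $F$. The rank of a valuation ring is its Krull dimension. For $X\subseteq\operatorname{Zar}(F)$ put $A(X)=\bigcap_{V\in X}V$ and, for $X$ nonempty, $J(X)=\bigcap_{V\in X}\mathfrak M_V$; by convention $A(\emptyset)=F$. The patch topology on $\operatorname{Zar}(F)$ is the topology having as a basis the sets $\{V: x_1,\dots,x_n\in V,\ y_1\notin V,\dots,y_m\notin V\}$ with $x_i,y_j\in F$, $n,m\ge 0$ (it is compact Hausdorff). $\lim(X)$ is the set of limit points of $X$ in $\operatorname{Zar}(F)$ in the patch topology, i.e. those $U\in\operatorname{Zar}(F)$ such that every patch open neighborhood of $U$ contains a point of $X$ different from $U$. A Prüfer domain is a domain whose localization at each maximal ideal is a valuation domain. A $G$-domain is a domain for which the intersection of the nonzero prime ideals is nonzero (a field counts as a $G$-domain and as a Prüfer domain). *)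

(* Defs.v *)
From HB Require Import structures.
From mathcomp Require Import all_boot all_order all_algebra.
From mathcomp Require Import all_classical topology.

Set Implicit Arguments.
Unset Strict Implicit.
Unset Printing Implicit Defensive.

Import GRing.Theory.
Local Open Scope classical_set_scope.
Local Open Scope ring_scope.

(* Subrings of F, and ideals of subrings, are represented as sets of elements
   of F; quotient fields and localizations are likewise formed inside F. *)
Section SubringsOfAField.
Variable F : fieldType.
Implicit Types A V I P M : set F.

Definition subring A := GRing.subring_closed (mem A).

Definition ideal A I :=
  [/\ I `<=` A, I 0, forall x y, I x -> I y -> I (x + y)
    & forall a x, A a -> I x -> I (a * x)].

Definition prime_ideal A P :=
  [/\ ideal A P, P <> A
    & forall x y, A x -> A y -> P (x * y) -> P x \/ P y].

Definition maximal_ideal A M :=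
  [/\ ideal A M, M <> A
    & forall I, ideal A I -> M `<=` I -> I = M \/ I = A].

Definition prime_chain A (n : nat) (C : nat -> set F) :=
  (forall i, (i <= n)%N -> prime_ideal A (C i)) /\
  (forall i, (i < n)%N -> C i `<` C i.+1).

Definition krull_dim A (n : nat) :=
  (exists C, prime_chain A n C) /\
  (forall m C, prime_chain A m C -> (m <= n)%N).

Definition quotient_field A : set F :=
  [set x | exists a b, [/\ A a, A b, b != 0 & x = a / b]].

Definition localization A P : set F :=
  [set x | exists a s, [/\ A a, A s, ~ P s & x = a / s]].

Definition valuation_domain A :=
  subring A /\ forall t, quotient_field A t -> t != 0 -> A t \/ A t^-1.

Definition prufer_domain A :=
  subring A /\
  forall M, maximal_ideal A M -> valuation_domain (localization A M).

(* Intersecting with A makes the empty intersection equal to A, so that a field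
   is a G-domain. *)
Definition G_domain A :=
  subring A /\
  A `&` \bigcap_(P in [set P | prime_ideal A P /\ P <> [set 0]]) P
    <> [set 0].

Definition valuation_ring V :=
  subring V /\ forall t, t != 0 -> V t \/ V t^-1.

End SubringsOfAField.

Record Zar (F : fieldType) := MkZar {
  Zar_set :> set F;
  Zar_valuation_ring : valuation_ring Zar_set }.

Section Zar.
Variable F : fieldType.
Implicit Types (V : Zar F) (X : set (Zar F)).

Definition rank V (n : nat) := krull_dim V n.

Definition maxid V : set F := xget set0 [set M | maximal_ideal V M].

Definition A_of X : set F := \bigcap_(V in X) (V : set F).

Definition J_of X : set F := \bigcap_(V in X) maxid V.

Definition patch_basic (xy : seq F * seq F) : set (Zar F) :=
  [set V : Zar F | (forall x, x \in xy.1 -> Zar_set V x) /\ (forall y, y \in xy.2 -> ~ Zar_set V y)].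

Lemma patch_basic_cover : \bigcup_(xy in [set: seq F * seq F]) patch_basic xy = setT.
Proof. by apply/seteqP; split=> // V _; exists ([::], [::]). Qed.

Lemma patch_basic_join (i j : seq F * seq F) V :
  setT i -> setT j -> patch_basic i V -> patch_basic j V ->
  exists k, [/\ setT k, patch_basic k V
              & patch_basic k `<=` patch_basic i `&` patch_basic j].
Proof.
move=> _ _ [ix iy] [jx jy]; exists (i.1 ++ j.1, i.2 ++ j.2); split=> //.
  split=> x /=; rewrite mem_cat => /orP[]; [exact: ix|exact: jx|exact: iy|].
  exact: jy.
move=> W [/= Wx Wy]; split; split=> x xi.
- by apply: Wx; rewrite mem_cat xi.
- by apply: Wy; rewrite mem_cat xi.
- by apply: Wx; rewrite mem_cat xi orbT.
- by apply: Wy; rewrite mem_cat xi orbT.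
Qed.

End Zar.

HB.instance Definition _ (F : fieldType) := gen_eqMixin (Zar F).
HB.instance Definition _ (F : fieldType) := gen_choiceMixin (Zar F).

HB.instance Definition _ (T : choiceType) := isPointed.Build (seq T) [::].

HB.instance Definition _ (F : fieldType) :=
  isBaseTopological.Build (Zar F) (@patch_basic_cover F) (@patch_basic_join F).

Section MaximalIdeal.
Variables (F : fieldType) (V : Zar F).
Implicit Types M I : set F.

Definition nonunits : set F :=
  [set x | Zar_set V x /\ (x = 0 \/ ~ Zar_set V x^-1)].

Let V1 : Zar_set V 1.
Proof. by case: (Zar_valuation_ring V) => -[/set_mem]. Qed.

Let VB x y : Zar_set V x -> Zar_set V y -> Zar_set V (x - y).
Proof.
by case: (Zar_valuation_ring V) => -[_ B _] _ /mem_set Vx /mem_set Vy;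
   apply/set_mem/B.
Qed.

Let VM x y : Zar_set V x -> Zar_set V y -> Zar_set V (x * y).
Proof.
by case: (Zar_valuation_ring V) => -[_ _ M] _ /mem_set Vx /mem_set Vy;
   apply/set_mem/M.
Qed.

Let V0 : Zar_set V 0.
Proof. by rewrite -(subrr 1); apply: VB. Qed.

Let VD x y : Zar_set V x -> Zar_set V y -> Zar_set V (x + y).
Proof. by move=> Vx Vy; rewrite -[y]opprK -[- y]add0r; do !apply: VB. Qed.

Let nonunitsD_aux x y : x != 0 -> y != 0 -> ~ Zar_set V y^-1 ->
  Zar_set V (x / y) -> x + y = 0 \/ ~ Zar_set V (x + y)^-1.
Proof.
move=> x0 y0 ny Vxy; have [->|s0] := eqVneq (x + y) 0; [by left|right=> Vs].
apply: ny; suff -> : y^-1 = (x + y)^-1 * (x / y + 1) by apply/VM/VD.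
by rewrite -[1](divff y0) -mulrDl mulrA mulVf // mul1r.
Qed.

Lemma nonunits_ideal : ideal V nonunits.
Proof.
split=> [x []//||x y|a x Va]; first by split; [|left].
- move=> [Vx nx] [Vy ny]; split; first exact: VD.
  have [x0|x0] := eqVneq x 0; first by rewrite x0 add0r.
  have [y0|y0] := eqVneq y 0; first by rewrite y0 addr0.
  case: nx => [/eqP|nx]; first by rewrite (negPf x0).
  case: ny => [/eqP|ny]; first by rewrite (negPf y0).
  have [_ /(_ (x / y))] := Zar_valuation_ring V.
  case; first by rewrite mulf_neq0 ?invr_eq0.
    exact: nonunitsD_aux.
  by rewrite invf_div addrC; apply: nonunitsD_aux.
- move=> [Vx nx]; split; first exact: VM.
  have [->|a0] := eqVneq a 0; first by left; rewrite mul0r.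
  case: nx => [->|nx]; first by left; rewrite mulr0.
  right=> Vax; apply: nx; suff -> : x^-1 = a * (a * x)^-1 by exact: VM.
  by rewrite invfM mulrA divff // mul1r.
Qed.

Let ideal_sub_nonunits I : ideal V I -> I <> V -> I `<=` nonunits.
Proof.
move=> [IV I0 ID IM] InV x Ix; split; first exact: IV.
have [->|x0] := eqVneq x 0; [by left|right=> Vx; apply: InV].
apply/seteqP; split=> // y Vy; have : I (y * x^-1 * x) by apply/IM/Ix/VM.
by rewrite -mulrA mulVf // mulr1.
Qed.

Let nonunits_neq : nonunits <> V.
Proof.
move=> E; have : nonunits 1 by rewrite E.
by case=> _ []; [move/eqP; rewrite oner_eq0|rewrite invr1].
Qed.

Lemma maximal_ideal_ZarE M : maximal_ideal V M <-> M = nonunits.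
Proof.
split=> [[iM MV maxM]|->].
  by have [//|/nonunits_neq] := maxM _ nonunits_ideal (ideal_sub_nonunits iM MV).
split=> // [|I iI nI]; first exact: nonunits_ideal.
have [->|IV] := pselect (I = V); first by right.
by left; apply/seteqP; split=> //; apply: ideal_sub_nonunits.
Qed.

Lemma maximal_idealP M : maximal_ideal V M <-> M = maxid V.
Proof.
have /maximal_ideal_ZarE mx : maximal_ideal V (maxid V).
  by apply: (@xgetPex _ set0 [set M | maximal_ideal V M]); exists nonunits;
     apply/maximal_ideal_ZarE.
by rewrite mx; exact: maximal_ideal_ZarE.
Qed.

End MaximalIdeal.

(* Main.v *)
Require Import Defs.
From mathcomp Require Import all_boot all_order all_algebra.
From mathcomp Require Import all_classical topology.
From mathcomp Require Import ring.

(** The two conditions on a subring A of F with quotient field F are first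
    made elementwise.
    - A is a G-domain with quotient field F iff F = A[1/d] for some nonzero d
      in A ([G_domainP]).
    - A is then Pruefer iff every t <> 0 in F has an a in A with a t and
      (1 - a) / t in A ([prufer_splits], [splits_prufer]): the conductors of t
      and of 1/t are comaximal.
    Both conditions visibly pass to overrings. Since limit points of X contain
    A(X), this gives everything in the direct implication except J(X) <> 0,
    and for that d itself is in J(X): a rank one V is not F, so d, whose
    inverse generates F over V, is not a unit of V.

    For the converse put B = A(lim X). Two facts replace the topology and the
    rank hypothesis.
    - An element of B lies outside only finitely many V in X ([finite_poles]):
      along a nonprincipal ultrafilter on infinitely many exceptions, the
      valuation rings would converge to a limit point of X that does not
      contain the element.
    - If V has rank one and d is in its maximal ideal, every f in F satisfies
      f d^n in V for some n ([rank1_archimedean]).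
    So a product that is right for B can be repaired at its finitely many
    exceptions by a power of an element of J(X); this yields a d in J(X) with
    F = A(X)[1/d] ([G_element_descent]).

    For the Pruefer condition at t, choose b in B which splits t there. It
    works for all V in X but finitely many, namely those that omit one of
    b, b t, (1 - b) / t. The exceptions have a common splitting element a. The
    two are glued as b + (1 - e) (a - b), where e is close to 1 at the V where
    b works and close to 0 at the exceptions. Both e and a come from one
    formula: if c is in J(X) and x lies outside only finitely many V in X,
    then for large n the element 1 / (1 + x^n c) is congruent to 1 modulo c
    where x is integral and divisible by c elsewhere ([exists_separator]).
    Limit points of higher rank, to which this argument does not apply, never
    interfere, because x is only ever an element of B, or the set of valuation
    rings at hand is finite. *)

Set Implicit Arguments.
Unset Strict Implicit.

Import GRing.Theory.
Local Open Scope classical_set_scope.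
Local Open Scope ring_scope.

(** * Subrings of a field and their ideals *)

Section Subring.
Variables (F : fieldType) (A : set F).
Hypothesis sA : subring A.

Lemma subring1 : A 1.
Proof. by case: sA => /set_mem. Qed.

Lemma subringB x y : A x -> A y -> A (x - y).
Proof. by case: sA => _ B _ /mem_set Ax /mem_set Ay; apply/set_mem/B. Qed.

Lemma subringM x y : A x -> A y -> A (x * y).
Proof. by case: sA => _ _ M /mem_set Ax /mem_set Ay; apply/set_mem/M. Qed.

Lemma subring0 : A 0.
Proof. by rewrite -(subrr 1); apply: subringB; apply: subring1. Qed.

Lemma subringN x : A x -> A (- x).
Proof. by move=> Ax; rewrite -[- x]add0r; apply: subringB => //; exact: subring0. Qed.

Lemma subringD x y : A x -> A y -> A (x + y).
Proof. by move=> Ax Ay; rewrite -[y]opprK; apply/subringB/subringN. Qed.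

Lemma subringX x n : A x -> A (x ^+ n).
Proof.
move=> Ax; elim: n => [|n IH]; rewrite ?expr0 ?exprS; first exact: subring1.
exact: subringM.
Qed.

Lemma subring_mulX_le f d n m : A d -> (n <= m)%N ->
  A (f * d ^+ n) -> A (f * d ^+ m).
Proof.
move=> Ad /subnKC<- Af; rewrite exprD mulrA.
by apply: subringM => //; apply: subringX.
Qed.

Lemma ideal_eq I : ideal A I -> I 1 -> I = A.
Proof.
move=> [IA _ _ IM] I1; apply/seteqP; split=> // x Ax.
by rewrite -[x]mulr1; apply: IM.
Qed.

Lemma ideal_add_principal I x : ideal A I -> A x ->
  ideal A [set z | exists m a, [/\ I m, A a & z = m + a * x]].
Proof.
move=> [IA I0 ID IM] Ax; split.
- by move=> _ [m [a [Im Aa ->]]]; apply: subringD; [exact: IA|exact: subringM].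
- by exists 0, 0; split; [|exact: subring0|ring].
- move=> _ _ [m [a [Im Aa ->]]] [m' [a' [Im' Aa' ->]]].
  by exists (m + m'), (a + a'); split; [exact: ID|exact: subringD|ring].
- move=> c _ Ac [m [a [Im Aa ->]]].
  by exists (c * m), (c * a); split; [exact: IM|exact: subringM|ring].
Qed.

End Subring.

(** Taking S = {1} gives the maximal ideals, and S = {d^n} the primes needed to
    show that d is in the radical of a principal ideal; one Zorn argument serves for both. *)
Definition max_avoiding (F : fieldType) (A S M : set F) :=
  [/\ ideal A M, S `<=` ~` M
    & forall I, ideal A I -> M `<=` I -> S `<=` ~` I -> I = M].

Lemma exists_max_avoiding (F : fieldType) (A S I : set F) :
  ideal A I -> S `<=` ~` I -> exists2 M, max_avoiding A S M & I `<=` M.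
Proof.
move=> iI SI.
(* Joining I to every member of a chain makes the empty chain harmless. *)
pose P J := ideal A (I `|` J) /\ S `<=` ~` (I `|` J).
have [C CP Ctot|J [[iM SM] maxJ]] := Zorn_bigcup (P := P).
  have [C0|/set0P[J0 CJ0]] := eqVneq C set0.
    by rewrite /P C0 bigcup_set0 setU0.
  have IC (z : F) : (I `|` \bigcup_(J in C) J) z ->
      exists2 J, C J & (I `|` J) z.
    by move=> [Iz|[J CJ Jz]]; [exists J0 => //; left|exists J => //; right].
  have CI J : C J -> I `|` J `<=` I `|` \bigcup_(J in C) J.
    by move=> CJ z [|Jz]; [left|right; exists J].
  split; last first.
    by move=> z Sz /IC[J CJ]; have [_] := CP _ CJ; apply.
  split.
  - by move=> z /IC[J CJ]; have [[+ _ _ _] _] := CP _ CJ; apply.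
  - by left; case: iI.
  - move=> x y /IC[J CJ Jx] /IC[K CK Ky].
    wlog JK : J K x y CJ CK Jx Ky / J `<=` K.
      move=> H; have [JK|KJ] := Ctot _ _ CJ CK; first exact: (H J K).
      by rewrite addrC; apply: (H K J).
    have [[_ _ KD _] _] := CP _ CK.
    apply: (CI _ CK); apply: KD => //.
    by case: Jx => [|/JK]; [left|right].
  - move=> a x Aa /IC[J CJ Jx]; apply: (CI _ CJ).
    by have [[_ _ _ JM] _] := CP _ CJ; apply: JM.
exists (I `|` J); last exact: subsetUl.
split=> // K iK MK SK; apply: contrapT => KM.
apply: (maxJ K); last by rewrite /P setUidr // => z Iz; apply: MK; left.
split=> [z Jz|KJ]; first by apply: MK; right.
by apply: KM; apply/seteqP; split=> // z /KJ; right.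
Qed.

(** If x and y are not in M, then both M + A x and M + A y meet S, and the
    product of two such elements of S lies in M as soon as x y does. *)
Lemma max_avoiding_prime (F : fieldType) (A S M : set F) :
  subring A -> S 1 -> (forall x y, S x -> S y -> S (x * y)) ->
  max_avoiding A S M -> prime_ideal A M.
Proof.
move=> sA S1 SM [iM SnM maxM]; split=> // [E|x y Ax Ay Mxy].
  by apply: (SnM _ S1); rewrite E; apply: subring1.
have meet z : A z -> ~ M z -> exists s m a, [/\ S s, M m, A a & s = m + a * z].
  move=> Az nMz; apply: contrapT => H; apply: nMz.
  rewrite -(maxM _ (ideal_add_principal sA iM Az)).
  - exists 0, 1; split; [by case: iM|exact: subring1|ring].
  - by move=> m Mm; exists m, 0; split=> //; [exact: subring0|ring].
  - by move=> s Ss [m [a [Mm Aa E]]]; apply: H; exists s, m, a.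
have [IA _ MD MM] := iM.
apply: contrapT => /not_orP[/(meet _ Ax)[s [m [a [Ss Mm Aa Es]]]]].
move=> /(meet _ Ay)[s' [m' [a' [Ss' Mm' Aa' Es']]]].
apply: (SnM _ (SM _ _ Ss Ss')).
have -> : s * s' = s' * m + (a * x * m' + a * a' * (x * y)) by rewrite Es Es'; ring.
apply: (MD); [|apply: (MD)]; apply: MM => //; try exact: subringM.
by rewrite Es'; apply: subringD => //; [exact: IA|exact: subringM].
Qed.

Lemma max_avoiding1 (F : fieldType) (A M : set F) :
  subring A -> max_avoiding A [set 1] M <-> maximal_ideal A M.
Proof.
move=> sA; split=> [[iM nM maxM]|[iM MA maxM]].
  split=> // [E|I iI MI]; first by apply: (nM 1) => //; rewrite E; apply: subring1.
  have [I1|nI1] := pselect (I 1); first by right; apply: ideal_eq.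
  by left; apply: maxM => // _ ->.
split=> // [_ -> M1|I iI MI nI]; first by apply: MA; apply: ideal_eq.
by have [//|E] := maxM _ iI MI; case: (nI 1) => //; rewrite E; apply: subring1.
Qed.

(** * Pruefer domains and G-domains with a given quotient field *)

(** Comaximality of the conductors of t and of 1/t, witnessed by
    1 = a + (1 - a). *)
Definition splits (F : fieldType) (A : set F) (t a : F) :=
  [/\ A a, A (a * t) & A ((1 - a) / t)].

(** Were the sum of the two conductors contained in a maximal ideal M,
    neither t nor 1/t could have a denominator outside M. *)
Lemma prufer_splits (F : fieldType) (A : set F) :
  prufer_domain A -> quotient_field A = setT ->
  forall t, t != 0 -> exists a, splits A t a.
Proof.
move=> [sA pA] qA t t0.
pose I : set F :=
  [set z | exists p q, [/\ A p, A (p * t), A q, A (q / t) & z = p + q]].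
have iI : ideal A I.
  split.
  - by move=> _ [p [q [Ap _ Aq _ ->]]]; apply: subringD.
  - by exists 0, 0; rewrite !mul0r addr0; split=> //; apply: subring0.
  - move=> _ _ [p [q [? ? ? ? ->]]] [p' [q' [? ? ? ? ->]]].
    by exists (p + p'), (q + q'); rewrite !mulrDl; split; try exact: subringD; ring.
  - move=> c _ Ac [p [q [? ? ? ? ->]]].
    by exists (c * p), (c * q); rewrite -!mulrA; split; try exact: subringM; ring.
have [[p [q [Ap Apt Aq Aqt E]]]|nI1] := pselect (I 1).
  by exists p; split=> //; rewrite E addrC addKr.
have [|M /(max_avoiding1 _ sA) mM IM] := exists_max_avoiding (S := [set 1]) iI.
  by move=> _ ->.
have Mdom x : A x -> A (x * t) -> M x.
  move=> Ax Axt; apply: IM; exists x, 0; rewrite mul0r addr0.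
  by split=> //; apply: subring0.
have Mdom' x : A x -> A (x / t) -> M x.
  move=> Ax Axt; apply: IM; exists 0, x; rewrite mul0r add0r.
  by split=> //; apply: subring0.
have [sAM] := pA _ mM.
have nz s : ~ M s -> s != 0.
  by apply: contra_notN => /eqP->; case: mM => -[].
have qt : quotient_field (localization A M) t.
  have [a [b [Aa Ab b0 ->]]] : quotient_field A t by rewrite qA.
  exists a, b; split=> //; [exists a, 1|exists b, 1];
    rewrite divr1; split=> //; try exact: subring1;
    by move=> M1; apply: nI1; case: mM => iM MA _; case: MA; apply: ideal_eq.
move=> /(_ t qt t0)[] [a [s [Aa As nMs E]]]; exfalso; apply: (nMs).
- by apply: Mdom => //; rewrite E mulrCA divff ?mulr1 ?nz.
- by apply: Mdom' => //; rewrite E mulrCA divff ?mulr1 ?nz.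
Qed.

(** For each maximal ideal M, one of a and 1 - a is outside M, and serves as a
    denominator for t or for 1/t. *)
Lemma splits_prufer (F : fieldType) (A : set F) :
  subring A -> (forall t, t != 0 -> exists a, splits A t a) -> prufer_domain A.
Proof.
move=> sA splitA; split=> // M mM.
have [iM MA MP] : prime_ideal A M.
  apply: (max_avoiding_prime (S := [set 1])) => //; last exact/max_avoiding1.
  by move=> _ _ -> ->; rewrite mulr1.
have [IA M0 MD MM] := iM.
have nM1 : ~ M 1 by move=> M1; apply: MA; apply: ideal_eq.
have nz s : ~ M s -> s != 0 by apply: contra_notN => /eqP->.
have nMM s s' : A s -> A s' -> ~ M s -> ~ M s' -> ~ M (s * s').
  by move=> As As' nMs nMs' /MP-/(_ As As')[].
split; last first.
  move=> t _ t0; have [a [Aa Aat Abt]] := splitA t t0.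
  have [Ma|nMa] := pselect (M a); [right|left]; last first.
    by exists (a * t), a; split=> //; rewrite mulrAC divff ?mul1r ?nz.
  have nMb : ~ M (1 - a) by move=> Mb; apply: nM1; rewrite -(subrK a 1); apply: (MD).
  exists ((1 - a) / t), (1 - a); split=> //.
    by apply: subringB => //; apply: subring1.
  by rewrite mulrAC divff ?mul1r ?nz.
split.
- by apply/mem_set; exists 1, 1; rewrite divr1; split=> //; apply: subring1.
- move=> _ _ /set_mem[a [s [Aa As nMs ->]]] /set_mem[b [u [Ab Au nMu ->]]].
  apply/mem_set; exists (a * u - b * s), (s * u).
  split; [|exact: subringM|exact: nMM|].
    by apply: subringB => //; apply: subringM.
  by field; rewrite !nz.
- move=> _ _ /set_mem[a [s [Aa As nMs ->]]] /set_mem[b [u [Ab Au nMu ->]]].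
  apply/mem_set; exists (a * b), (s * u).
  by split; [exact: subringM|exact: subringM|exact: nMM|field; rewrite !nz].
Qed.

(** This says that F = A[1/d]. *)
Definition G_element (F : fieldType) (A : set F) (d : F) :=
  [/\ A d, d != 0 & forall f, exists n, A (f * d ^+ n)].

(** If d lies in all nonzero primes and b <> 0, then some power of d is in b A
    (otherwise an ideal containing b and maximal among those avoiding the
    powers of d would be a nonzero prime without d), so powers of d serve as
    denominators for F. Conversely, for p <> 0 in a prime P some d^n / p is in
    A, whence d^n, and so d, is in P. *)
Lemma G_domainP (F : fieldType) (A : set F) : subring A ->
  G_domain A /\ quotient_field A = setT <-> exists d, G_element A d.
Proof.
move=> sA; split=> [[[_ GA] qA]|[d [Ad d0 dA]]].
  have [d [[Ad dP] d0]] : exists d, (A `&`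
      \bigcap_(P in [set P | prime_ideal A P /\ P <> [set 0]]) P) d /\ d != 0.
    apply: contrapT => H; apply: GA; apply/seteqP; split=> [z Iz|_ ->].
      by apply: contrapT => /eqP z0; apply: H; exists z.
    by split=> [|P [[[]]]] //; apply: subring0.
  exists d; split=> // f.
  have [a [b [Aa Ab b0 ->]]] : quotient_field A f by rewrite qA.
  pose I := [set z | exists2 c, A c & z = c * b].
  have iI : ideal A I.
    split.
    - by move=> _ [c Ac ->]; apply: subringM.
    - by exists 0; [exact: subring0|rewrite mul0r].
    - by move=> _ _ [c Ac ->] [c' Ac' ->]; exists (c + c'); [exact: subringD|ring].
    - by move=> e _ Ae [c Ac ->]; exists (e * c); [exact: subringM|ring].
  have [[n [c Ac E]]|nI] := pselect (exists n, I (d ^+ n)).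
    by exists n; rewrite E mulrC mulrACA mulfV // mulr1; apply: subringM.
  have [|P mP IP] := exists_max_avoiding (S := range (fun n => d ^+ n)) iI.
    by move=> _ [n _ <-] Id; apply: nI; exists n.
  have [|x y [n _ <-] [m _ <-]|] := max_avoiding_prime sA _ _ mP.
  - by exists 0.
  - by exists (n + m)%N => //; rewrite exprD.
  move=> iP PA PP; have [_ /(_ d) nPd _] := mP.
  case: nPd; first by exists 1.
  apply: dP; split=> // P0; move/eqP: b0; apply.
  have : P b by apply: IP; exists 1; [exact: subring1|rewrite mul1r].
  by rewrite P0.
split; last first.
  apply/seteqP; split=> // f _; have [n Afd] := dA f.
  exists (f * d ^+ n), (d ^+ n); split=> //; first exact: subringX.
    by rewrite expf_neq0.
  by rewrite mulfK ?expf_neq0.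
split=> // E.
suff : [set 0] d by move/eqP; rewrite (negPf d0).
rewrite -E; split=> // P [[iP PA PP] P0].
have [IA IP0 _ IM] := iP.
have [p Pp p0] : exists2 p, P p & p != 0.
  apply: contrapT => H; apply: P0; apply/seteqP; split=> [z Pz|_ ->] //.
  by apply: contrapT => /eqP z0; apply: H; exists z.
have [n Apd] := dA p^-1.
have : P (d ^+ n) by rewrite -(divfK p0 (d ^+ n)) [_ / p]mulrC; apply: IM.
elim: n {Apd} => [P1|n IH]; first by case: PA; apply: ideal_eq.
by rewrite exprS => /PP[] //; apply: subringX.
Qed.

Lemma splits_sub (F : fieldType) (A B : set F) t a :
  A `<=` B -> splits A t a -> splits B t a.
Proof. by move=> AB [? ? ?]; split; apply: AB. Qed.

(** Splitting elements may be perturbed by anything small relative to t and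
    1/t; this makes gluing by approximation possible. *)
Lemma splitsD (F : fieldType) (A : set F) t a u : subring A ->
  splits A t a -> A u -> A (u * t) -> A (u / t) -> splits A t (a + u).
Proof.
move=> sA [Aa Aat Abt] Au Aut Aut'; split; first exact: subringD.
  by rewrite mulrDl; apply: subringD.
by rewrite opprD addrA mulrBl; apply: subringB.
Qed.

(** * Valuation rings *)

Section ValuationRing.
Variables (F : fieldType) (V : Zar F).

Lemma Zar_subring : subring V.
Proof. by case: (Zar_valuation_ring V). Qed.
Let sV := Zar_subring.

Lemma Zar_inv t : ~ Zar_set V t -> t != 0 /\ Zar_set V t^-1.
Proof.
move=> nVt; have t0 : t != 0 by apply: contra_notN nVt => /eqP->; apply: subring0.
by split=> //; have [_ /(_ t t0)[]] := Zar_valuation_ring V.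
Qed.

Lemma maxid_nonunits : maxid V = nonunits V.
Proof. by apply/maximal_ideal_ZarE/maximal_idealP. Qed.

Lemma nonunits_inv x : ~ Zar_set V x -> nonunits V x^-1.
Proof. by move=> nVx; have [_ Vx] := Zar_inv nVx; split=> //; right; rewrite invrK. Qed.

Lemma nonunitsM a x : Zar_set V a -> nonunits V x -> nonunits V (a * x).
Proof. by have [_ _ _ M] := nonunits_ideal V; apply: M. Qed.

Lemma nonunits_not1 : ~ nonunits V 1.
Proof.
by case=> _ []; [move/eqP; rewrite oner_eq0|rewrite invr1; apply; apply: subring1].
Qed.

Lemma nonunits_add1 x : nonunits V x -> 1 + x != 0 /\ Zar_set V (1 + x)^-1.
Proof.
move=> Mx; have [IV _ MD MM] := nonunits_ideal V.
have nM : ~ nonunits V (1 + x).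
  move=> M1; apply: nonunits_not1; rewrite -(addrK x 1); apply: MD => //.
  by rewrite -mulN1r; apply: MM => //; apply: subringN => //; apply: subring1.
have V1x : Zar_set V (1 + x) by apply: subringD; [|exact: subring1|exact: IV].
split; first by apply: contra_notN nM => /eqP->; split; [exact: subring0|left].
by apply: contrapT => nV; apply: nM; split=> //; right.
Qed.

Lemma nonunits_prime : prime_ideal V (nonunits V).
Proof.
apply: (max_avoiding_prime (S := [set 1])) => //.
  by move=> _ _ -> ->; rewrite mulr1.
exact/max_avoiding1/maximal_ideal_ZarE.
Qed.

Lemma zero_prime : prime_ideal V [set 0].
Proof.
split; [split|..] => //.
- by move=> _ ->; apply: subring0.
- by move=> _ _ -> ->; rewrite addr0.
- by move=> a _ _ ->; rewrite mulr0.
- move=> E; have /eqP : [set 0] (1 : F) by rewrite E; apply: subring1.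
  by rewrite oner_eq0.
- by move=> x y _ _ /eqP; rewrite mulf_eq0 => /orP[]/eqP; [left|right].
Qed.

(** If x / d^n and y / d^m are not in V, their inverses are, and if moreover
    x y / d^(n + m + 1) is in V then so is 1/d. *)
Lemma divisible_prime d : nonunits V d -> d != 0 ->
  prime_ideal V [set x | forall n, Zar_set V (x / d ^+ n)].
Proof.
move=> [Vd]; case=> [->|nVd] d0; first by rewrite eqxx in d0.
have dn0 n : d ^+ n != 0 by rewrite expf_neq0.
split; [split|..].
- by move=> x /(_ 0); rewrite divr1.
- by move=> n; rewrite mul0r; apply: subring0.
- by move=> x y Px Py n; rewrite mulrDl; apply: subringD.
- by move=> a x Va Px n; rewrite -mulrA; apply: subringM.
- move=> E; have : Zar_set V d -> Zar_set V (d / d ^+ 2) by rewrite -{1}E; apply.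
  by rewrite expr2 invfM mulrA divff // mul1r => /(_ Vd).
move=> x y Vx Vy Pxy; apply: contrapT => /not_orP[].
move=> /existsNP[n /Zar_inv[xn0 Vn]] /existsNP[m /Zar_inv[ym0 Vm]].
have x0 : x != 0 by apply: contraNneq xn0 => ->; rewrite mul0r.
have y0 : y != 0 by apply: contraNneq ym0 => ->; rewrite mul0r.
apply: nVd.
suff -> : d^-1 = x * y / d ^+ (n + m).+1 * ((x / d ^+ n)^-1 * (y / d ^+ m)^-1).
  by apply: subringM => //; apply: subringM.
by rewrite exprS exprD; field; rewrite d0 x0 y0 !dn0.
Qed.

(** If no f d^n is in V, then 1/f is a nonzero element of the intersection of
    the d^n V, so 0, this intersection and the maximal ideal form a chain of
    three primes. *)
Lemma rank1_archimedean d f : rank V 1 -> nonunits V d ->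
  exists n, Zar_set V (f * d ^+ n).
Proof.
move=> [_ dim1] Md; have [Vd nVd] := Md.
have [->|d0] := eqVneq d 0; first by exists 1; rewrite mulr0; apply: subring0.
case: nVd => [/eqP|nVd]; first by rewrite (negPf d0).
apply: contrapT => /forallNP nVf.
have [f0 Vf] : f != 0 /\ Zar_set V f^-1.
  by apply: Zar_inv; have := nVf 0; rewrite mulr1.
pose P : set F := [set x | forall n, Zar_set V (x / d ^+ n)].
have Pf : P f^-1 by move=> n; rewrite -invfM; have [] := Zar_inv (nVf n).
have nPd : ~ P d.
  by move=> /(_ 2%N); rewrite expr2 invfM mulrA divff // mul1r.
have pP : prime_ideal V P by apply: divisible_prime.
pose C n : set F := if n is n'.+1 then if n' is 0 then P else nonunits V else [set 0].
suff : (2 <= 1)%N by [].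
apply: (dim1 _ C); split=> [[|[|i]] _|[|[|i]] //= _].
- exact: zero_prime.
- exact: pP.
- exact: nonunits_prime.
- split=> [_ ->|/(_ _ Pf)/eqP]; first by case: pP => -[].
  by rewrite invr_eq0 (negPf f0).
- split=> [x Px|/(_ _ Md)//].
  split; first by have := Px 0; rewrite divr1.
  have [x0|x0] := eqVneq x 0; [by left|right=> Vx; apply: nVd].
  suff -> : d^-1 = x / d ^+ 1 * x^-1 by apply: subringM.
  by rewrite mulrAC mulfV // mul1r.
Qed.

Lemma rank1_neq_setT : rank V 1 -> exists f, ~ Zar_set V f.
Proof.
move=> [[C [pC ltC]] _]; apply/existsNP => VT.
have [[iC0 iC0' _ _] _ _] := pC 0%N isT.
have [[_ _ _ CM] CV _] := pC 1%N isT.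
have [_] := ltC 0%N isT; apply=> x Cx.
have [->//|x0] := eqVneq x 0; case: CV; apply: ideal_eq.
  by case: (pC 1%N isT).
by rewrite -(mulVf x0); apply: CM.
Qed.

End ValuationRing.

Lemma A_of_subring (F : fieldType) (X : set (Zar F)) : subring (A_of X).
Proof.
split=> [|x y|x y].
- by apply/mem_set => V _; exact: (subring1 (Zar_subring V)).
- move=> /set_mem Ax /set_mem Ay; apply/mem_set => V XV.
  by apply: subringB; [exact: Zar_subring|exact: (Ax V)|exact: (Ay V)].
- move=> /set_mem Ax /set_mem Ay; apply/mem_set => V XV.
  by apply: subringM; [exact: Zar_subring|exact: (Ax V)|exact: (Ay V)].
Qed.

(** * Limit points in the patch topology *)

Lemma limit_point_patchP (F : fieldType) (X : set (Zar F)) (U : Zar F) :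
  limit_point X U <-> forall xy, patch_basic xy U ->
    exists V, [/\ V != U, X V & patch_basic xy V].
Proof.
split=> [lU xy Uxy|H N].
  apply: lU; rewrite nbhsE /=; exists (patch_basic xy) => //; split=> //.
  by exists [set xy] => //; rewrite bigcup_set1.
rewrite nbhsE => -[_ [[D _ <-] [xy Dxy Uxy]] sN].
have [V [VU XV Vxy]] := H _ Uxy.
by exists V; split=> //; apply: sN; exists xy.
Qed.

Lemma A_of_sub_limit_point (F : fieldType) (X : set (Zar F)) :
  A_of X `<=` A_of (limit_point X).
Proof.
move=> f Af U /limit_point_patchP lU; apply: contrapT => nUf.
have [|V [_ XV [_ /(_ f)]]] := lU ([::], [:: f]).
  by split=> //= y; rewrite inE => /eqP->.
by rewrite inE eqxx => /(_ isT); apply; apply: Af.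
Qed.

(** This is the limit of the ultrafilter in the patch topology; maximality of
    the filter yields the dichotomy between t and 1/t. *)
Lemma ultra_limit_valuation (F : fieldType) (G : set_system (Zar F)) :
  UltraFilter G -> valuation_ring [set x | G [set V | Zar_set V x]].
Proof.
move=> UG; split; first split=> [|x y|x y].
- apply/mem_set; apply: filterS filterT => V _; exact: (subring1 (Zar_subring V)).
- move=> /set_mem Gx /set_mem Gy; apply/mem_set.
  by apply: filterS2 Gx Gy => V Vx Vy; apply: subringB => //; apply: Zar_subring.
- move=> /set_mem Gx /set_mem Gy; apply/mem_set.
  by apply: filterS2 Gx Gy => V Vx Vy; apply: subringM => //; apply: Zar_subring.
move=> t t0; have [?|Gn] := in_ultra_setVsetC [set V : Zar F | Zar_set V t] UG.
  by left.
by right; apply: filterS Gn => V /Zar_inv[].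
Qed.

(** Infinitely many exceptions carry an ultrafilter containing their cofinite
    subsets. Its limit U omits g, and every patch neighborhood of U contains
    exceptions different from U, so U is a limit point of X. *)
Lemma finite_poles (F : fieldType) (X : set (Zar F)) g :
  A_of (limit_point X) g -> finite_set [set V | X V /\ ~ Zar_set V g].
Proof.
move=> Bg; apply: contrapT => infS; set S := [set V | _] in infS.
pose G0 : set_system (Zar F) := [set N | finite_set (S `\` N)].
have FG0 : Filter G0.
  split=> [|N N' fN fN'|N N' NN' fN].
  - by rewrite /G0 /= setDT.
  - by rewrite /G0 /= setDIr finite_setU.
  - by apply: sub_finite_set fN => V [SV nN']; split=> // /NN'.
have [|G [UG G0G]] := ultraFilterLemma (F := G0).
  by split=> //; rewrite /G0 /= setD0.
pose U := MkZar (ultra_limit_valuation UG).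
have GS : G S by apply: G0G; rewrite /G0 /= setDv.
have nUg : ~ Zar_set U g.
  by move=> /= Gg; have [V [[_ +]]] := filter_ex (filterI GS Gg).
apply: nUg; apply: Bg; apply/limit_point_patchP => -[xs ys] [/= Uxs Uys].
have Gpatch : G (patch_basic (xs, ys)).
  suff : (\forall V \near G, forall x, x \in xs -> Zar_set V x) /\
         (\forall V \near G, forall y, y \in ys -> ~ Zar_set V y).
    by case; apply: filterS2 => V.
  split.
    elim: xs Uxs => [|x xs IH] Uxs; first by apply: filterE.
    have Gx := Uxs x (mem_head _ _).
    have {IH}Gxs : \forall V \near G, forall x, x \in xs -> Zar_set V x.
      by apply: IH => z zxs; apply: Uxs; rewrite inE zxs orbT.
    by apply: filterS2 Gx Gxs => V Vx Vxs z; rewrite inE => /orP[/eqP->|/Vxs].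
  elim: ys Uys => [|y ys IH] Uys; first by apply: filterE.
  have [/Uys|Gy] := in_ultra_setVsetC [set V : Zar F | Zar_set V y] UG.
    by rewrite mem_head => /(_ isT).
  have {IH}Gys : \forall V \near G, forall y, y \in ys -> ~ Zar_set V y.
    by apply: IH => z zys; apply: Uys; rewrite inE zys orbT.
  by apply: filterS2 Gy Gys => V Vy Vys z; rewrite inE => /orP[/eqP->|/Vys].
have GU : G (~` [set U]).
  by apply: G0G; apply: sub_finite_set (finite_set1 U) => V [_ /contrapT].
have [V [[VU [XV _]] Vxy]] := filter_ex (filterI (filterI GU GS) Gpatch).
by exists V; split=> //; apply/eqP.
Qed.

(** * Separating finitely many poles *)

Lemma rank1_finite_archimedean (F : fieldType) (S : set (Zar F)) (d f : F) :
  finite_set S -> (forall V, S V -> rank V 1) ->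
  (forall V, S V -> nonunits V d) ->
  exists n, forall V, S V -> Zar_set V (f * d ^+ n).
Proof.
move=> /finite_seqP[s ->] {S}; elim: s => [|V s IH] S1 Sd.
  by exists 0%N => V.
have [|V' V's|n sn] := IH.
- by move=> V' V's; apply: S1; rewrite /= inE V's orbT.
- by apply: Sd; rewrite /= inE V's orbT.
have [|m Vm] := @rank1_archimedean _ V d f (S1 V (mem_head _ _)).
  exact: Sd V (mem_head _ _).
exists (n + m)%N => W Ws; have [Wd _] := Sd W Ws; have sW := Zar_subring W.
move: Ws => /=; rewrite inE => /orP[/eqP WV|/sn Wn].
- by move: Vm; rewrite -WV => Wm; apply: (subring_mulX_le sW) Wm; rewrite ?leq_addl.
- by apply: (subring_mulX_le sW) Wn; rewrite ?leq_addr.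
Qed.

Lemma finite_poles_archimedean (F : fieldType) (X : set (Zar F)) (d f : F) :
  (forall V, X V -> rank V 1) -> (forall V, X V -> nonunits V d) ->
  finite_set [set V | X V /\ ~ Zar_set V f] -> exists n, A_of X (f * d ^+ n).
Proof.
move=> X1 Xd finS.
have [||n Sn] := rank1_finite_archimedean (d := d) f finS.
- by move=> V [/X1].
- by move=> V [/Xd].
exists n => V XV; have [Vf|nVf] := pselect (Zar_set V f); last exact: Sn.
have [Vd _] := Xd _ XV; have sV := Zar_subring V.
by apply: subringM => //; apply: subringX.
Qed.

(** Take e = 1 / (1 + x^n c). Where x is in V, 1 + x^n c is a unit congruent to
    1 modulo c. Where x is not in V, n can be chosen by the archimedean
    property of powers of 1/x so that y = 1 / (x^n c^2) is in V; then y c is in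
    the maximal ideal and e = c y / (1 + y c). *)
Lemma exists_separator (F : fieldType) (X : set (Zar F)) (c x : F) :
  (forall V, X V -> rank V 1) -> (forall V, X V -> nonunits V c) -> c != 0 ->
  finite_set [set V | X V /\ ~ Zar_set V x] ->
  exists e, forall V, X V -> [/\ Zar_set V e,
    Zar_set V x -> Zar_set V ((1 - e) / c) & ~ Zar_set V x -> Zar_set V (e / c)].
Proof.
move=> X1 Xc c0 finS.
have [||n Sn] := rank1_finite_archimedean (d := x^-1) (c ^- 2) finS.
- by move=> V [/X1].
- by move=> V [_ /nonunits_inv].
exists (1 + x ^+ n * c)^-1 => V XV; have sV := Zar_subring V.
have Mc := Xc _ XV; have [Vc _] := Mc.
have [Vx|nVx] := pselect (Zar_set V x).
  have [u0 Vu] : 1 + x ^+ n * c != 0 /\ Zar_set V (1 + x ^+ n * c)^-1.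
    by apply/nonunits_add1/nonunitsM => //; apply: subringX.
  split=> // _.
  suff -> : (1 - (1 + x ^+ n * c)^-1) / c = x ^+ n * (1 + x ^+ n * c)^-1.
    by apply: subringM => //; apply: subringX.
  by field; rewrite c0 u0.
have [x0 _] := Zar_inv nVx.
pose y := c ^- 2 * x^-1 ^+ n.
have Vy : Zar_set V y by apply: Sn.
have [u0 Vu] : 1 + y * c != 0 /\ Zar_set V (1 + y * c)^-1.
  exact/nonunits_add1/nonunitsM.
have eE : (1 + x ^+ n * c)^-1 = c * (y * (1 + y * c)^-1).
  have xn0 : x ^+ n != 0 by rewrite expf_neq0.
  have yc : y * c = (x ^+ n * c)^-1 by rewrite /y exprVn; field; rewrite c0 xn0.
  have u0' : x ^+ n * c + 1 != 0.
    apply: contraNneq u0 => E; rewrite yc.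
    by rewrite -[1](divff (mulf_neq0 xn0 c0)) -[X in _ + X]mul1r -mulrDl E mul0r.
  rewrite mulrA [c * y]mulrC yc; field.
  by rewrite xn0 c0 u0'.
have Vyu : Zar_set V (y * (1 + y * c)^-1) by apply: subringM.
rewrite eE; split=> // [|_]; first exact: subringM.
by rewrite mulrAC mulfV // mul1r.
Qed.

(** Multiplying separators intersects the sets on which they are close to 1 and
    unites the sets on which they are close to 0. *)
Lemma exists_separator_seq (F : fieldType) (X : set (Zar F)) (c : F) (xs : seq F) :
  (forall V, X V -> rank V 1) -> (forall V, X V -> nonunits V c) -> c != 0 ->
  (forall x, x \in xs -> finite_set [set V | X V /\ ~ Zar_set V x]) ->
  exists e, forall V, X V -> [/\ Zar_set V e,
    (forall x, x \in xs -> Zar_set V x) -> Zar_set V ((1 - e) / c)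
    & (exists2 x, x \in xs & ~ Zar_set V x) -> Zar_set V (e / c)].
Proof.
move=> X1 Xc c0; elim: xs => [_|x xs IH finxs].
  exists 1 => V XV; have sV := Zar_subring V; split=> [|_|[//]].
    exact: (subring1 sV).
  by rewrite subrr mul0r; apply: subring0.
have [z zxs|e' He'] := IH; first by apply: finxs; rewrite inE zxs orbT.
have [e He] := exists_separator X1 Xc c0 (finxs x (mem_head _ _)).
exists (e * e') => V XV; have sV := Zar_subring V.
have [Ve gVe bVe] := He V XV; have [Ve' gVe' bVe'] := He' V XV.
split=> [|Vxs|[z]]; first exact: subringM.
  have -> : (1 - e * e') / c = (1 - e) / c + e * ((1 - e') / c).
    by field; rewrite c0.
  apply: subringD => //; first by apply: gVe; apply: Vxs; rewrite mem_head.
  apply: subringM => //; apply: gVe' => z zxs.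
  by apply: Vxs; rewrite inE zxs orbT.
rewrite inE => /orP[/eqP->|zxs] nVz; last first.
  by rewrite -mulrA; apply: subringM => //; apply: bVe'; exists z.
by rewrite mulrAC; apply: subringM => //; apply: bVe.
Qed.

(** A separator for t itself splits t, provided that its precision c is small
    enough to absorb both t and 1/t; the finiteness of S gives such a c. *)
Lemma finite_splits (F : fieldType) (S : set (Zar F)) (d t : F) :
  finite_set S -> (forall V, S V -> rank V 1) ->
  (forall V, S V -> nonunits V d) -> d != 0 -> t != 0 ->
  exists a, forall V, S V -> splits V t a.
Proof.
move=> finS S1 Sd d0 t0.
have [n Sn] := rank1_finite_archimedean t finS S1 Sd.
have [m Sm] := rank1_finite_archimedean t^-1 finS S1 Sd.
pose c := d ^+ (n + m).+1.
have [|||e He] := @exists_separator _ S c t S1.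
- move=> V SV; have [Vd _] := Sd V SV.
  rewrite /c exprSr; apply: nonunitsM (Sd V SV).
  by apply: subringX => //; apply: Zar_subring.
- by rewrite expf_neq0.
- by apply: sub_finite_set finS => V [].
exists e => V SV; have sV := Zar_subring V; have [Vd _] := Sd V SV.
have Vtc : Zar_set V (t * c).
  by apply: (subring_mulX_le sV) (Sn V SV); rewrite // -addnS leq_addr.
have Vtc' : Zar_set V (t^-1 * c).
  by apply: (subring_mulX_le sV) (Sm V SV); rewrite // -addSn leq_addl.
have c0 : c != 0 by rewrite expf_neq0.
have [Ve gVe bVe] := He V SV.
have [Vt|nVt] := pselect (Zar_set V t); split=> //.
- exact: subringM.
- have -> : (1 - e) / t = (1 - e) / c * (t^-1 * c) by field; rewrite t0 c0.
  by apply: subringM => //; apply: gVe.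
- have -> : e * t = e / c * (t * c) by field; rewrite c0.
  by apply: subringM => //; apply: bVe.
- have [_ Vt] := Zar_inv nVt.
  by apply: subringM => //; apply: subringB => //; apply: subring1.
Qed.

(** * The descent from limit points *)

Section Descent.
Variables (F : fieldType) (X : set (Zar F)).
Hypothesis X1 : forall V, X V -> rank V 1.
Let A := A_of X.
Let B := A_of (limit_point X).
Let sA : subring A := A_of_subring X.
Let sB : subring B := A_of_subring (limit_point X).

(** The element d0 of B may fail to be in some V of X, or be a unit of it. The
    first happens finitely often, so d0 j^n is in A for some n, and one more
    factor j moves it into every maximal ideal. *)
Lemma G_element_descent j d0 : (forall V, X V -> nonunits V j) -> j != 0 ->
  G_element B d0 -> exists2 d, G_element A d & forall V, X V -> nonunits V d.
Proof.
move=> Xj j0 [Bd0 d00 Bf].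
have Bj : B j by apply: A_of_sub_limit_point => V /Xj[].
have [n Ad0j] := finite_poles_archimedean X1 Xj (finite_poles Bd0).
pose d := d0 * j ^+ n * j.
have Xd V : X V -> nonunits V d by move=> XV; apply: nonunitsM (Xj V XV); apply: Ad0j.
exists d => //; split=> [V /Xd[]//||f]; first by rewrite !mulf_neq0 ?expf_neq0.
have [k Bfk] := Bf f.
have Bfd : B (f * d ^+ k).
  rewrite /d -mulrA -exprSr exprMn mulrA.
  by apply: (subringM sB) => //; do 2!apply: (subringX sB).
have [m Am] := finite_poles_archimedean X1 Xd (finite_poles Bfd).
by exists (k + m)%N; rewrite exprD mulrA.
Qed.

(** The finite set S of V in X at which b fails is described by membership of
    the three elements of xs, all in B, so that a separator exists exactly for
    S and its complement. *)
Lemma splits_descent d t : G_element A d -> (forall V, X V -> nonunits V d) ->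
  t != 0 -> (exists b, splits B t b) -> exists a, splits A t a.
Proof.
move=> [Ad d0 Af] Xd t0 [b [Bb Bbt Bbt']].
pose xs := [:: b; b * t; (1 - b) / t].
have finxs x : x \in xs -> finite_set [set V | X V /\ ~ Zar_set V x].
  by rewrite !inE => /or3P[]/eqP->; apply: finite_poles.
pose S : set (Zar F) := [set V | X V /\ exists2 x, x \in xs & ~ Zar_set V x].
have finS : finite_set S.
  have -> : S = \bigcup_(x in [set` xs]) [set V | X V /\ ~ Zar_set V x].
    apply/seteqP; split=> [V [XV [x xxs nVx]]|V [x xxs [XV nVx]]]; first by exists x.
    by split=> //; exists x.
  by apply: bigcup_finite => //; apply: finite_seq.
have [||a Sa] := finite_splits (d := d) (t := t) finS _ _ d0 t0.
- by move=> V [/X1].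
- by move=> V [/Xd].
pose w := a - b.
have [n1 An1] := Af w; have [n2 An2] := Af (w * t); have [n3 An3] := Af (w / t).
(* The precision c absorbs the difference of the two local solutions, also
   after multiplication by t and by 1/t. *)
pose c := d ^+ (n1 + n2 + n3).+1.
have c0 : c != 0 by rewrite expf_neq0.
have [|||e He] := @exists_separator_seq _ X c xs X1 => //.
  move=> V XV; rewrite /c exprSr; apply: nonunitsM (Xd V XV).
  by apply: subringX; [exact: Zar_subring|exact: (Ad V)].
have Aw : A (w * c).
  by apply: (subring_mulX_le sA) An1; rewrite // -!addnA -addnS leq_addr.
have Awt : A (w * t * c).
  apply: (subring_mulX_le sA) An2; rewrite //.
  by rewrite -addSn (leq_trans _ (leq_addr _ _)) // -addSn leq_addl.
have Awt' : A (w / t * c).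
  by apply: (subring_mulX_le sA) An3; rewrite // -addSn leq_addl.
exists (b + (1 - e) * w).
suff H V : X V -> splits V t (b + (1 - e) * w).
  by split=> V /H[].
move=> XV; have sV := Zar_subring V; have [Ve gVe bVe] := He V XV.
have Vw := Aw V XV; have Vwt := Awt V XV; have Vwt' := Awt' V XV.
have [SV|nSV] := pselect (S V).
  have Vec : Zar_set V (e / c) by apply: bVe; case: SV.
  have -> : b + (1 - e) * w = a + - (e / c * (w * c)) by rewrite /w; field.
  apply: (splitsD sV); [exact: Sa| | |].
  - by apply: subringN => //; apply: subringM.
  - have -> : - (e / c * (w * c)) * t = - (e / c * (w * t * c)) by ring.
    by apply: subringN => //; apply: subringM.
  - have -> : - (e / c * (w * c)) / t = - (e / c * (w / t * c)) by ring.
    by apply: subringN => //; apply: subringM.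
have Vxs x : x \in xs -> Zar_set V x.
  by move=> xxs; apply: contrapT => nVx; apply: nSV; split=> //; exists x.
have Vec := gVe Vxs.
have -> : b + (1 - e) * w = b + (1 - e) / c * (w * c) by field.
apply: (splitsD sV).
- by split; apply: Vxs; rewrite !inE eqxx ?orbT.
- exact: subringM.
- have -> : (1 - e) / c * (w * c) * t = (1 - e) / c * (w * t * c) by ring.
  exact: subringM.
- have -> : (1 - e) / c * (w * c) / t = (1 - e) / c * (w / t * c) by ring.
  exact: subringM.
Qed.

End Descent.

(** If d were a unit of V, then V would contain A[1/d] = F. *)
Lemma G_element_J_of (F : fieldType) (X : set (Zar F)) d :
  (forall V, X V -> rank V 1) -> G_element (A_of X) d -> J_of X d.
Proof.
move=> X1 [Ad d0 Af] V XV; rewrite maxid_nonunits; have sV := Zar_subring V.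
split; first exact: Ad.
right=> Vd; have [f nVf] := rank1_neq_setT (X1 V XV); apply: nVf.
have [n Afn] := Af f.
rewrite -(mulfK (expf_neq0 n d0) f) -exprVn.
by apply: subringM => //; [exact: Afn|exact: subringX].
Qed.

Unset Implicit Arguments.

Theorem corollary4p4 (F : fieldType) (X : set (Zar F))
    (X_nonempty : X !=set0) (X_rank1 : forall V, X V -> rank V 1) :
  [/\ prufer_domain (A_of X), G_domain (A_of X)
    & quotient_field (A_of X) = [set: F]] <->
  J_of X <> [set 0] /\
  [/\ prufer_domain (A_of (limit_point X)), G_domain (A_of (limit_point X))
    & quotient_field (A_of (limit_point X)) = [set: F]].
Proof.
have sA := A_of_subring X; have sB := A_of_subring (limit_point X).
split=> [[pA gA qA]|[J0 [pB gB qB]]].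
  have [d Gd] := (G_domainP sA).1 (conj gA qA); have [Ad d0 Af] := Gd.
  have AB := @A_of_sub_limit_point F X.
  split.
    move=> E; have := G_element_J_of X_rank1 Gd.
    by rewrite E => /eqP; rewrite (negPf d0).
  have [|gB qB] := (G_domainP sB).2.
    by exists d; split=> // [|f]; [exact: AB|have [n ?] := Af f; exists n; apply: AB].
  split=> //; apply: splits_prufer => // t /(prufer_splits pA qA)[a Aa].
  by exists a; apply: splits_sub Aa.
have [j Jj j0] : exists2 j, J_of X j & j != 0.
  have [V XV] := X_nonempty.
  apply: contrapT => H; apply: J0; apply/seteqP; split=> [z Jz|_ -> W _].
    by apply: contrapT => /eqP z0; apply: H; exists z.
  by rewrite maxid_nonunits; split; [exact: (subring0 (Zar_subring W))|left].
have Xj V : X V -> nonunits V j by rewrite -maxid_nonunits; apply: Jj.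
have [d0 Gd0] := (G_domainP sB).1 (conj gB qB).
have [d Gd Xd] := G_element_descent X_rank1 Xj j0 Gd0.
have [|gA qA] := (G_domainP sA).2; first by exists d.
split=> //; apply: splits_prufer => // t t0.
exact: (splits_descent X_rank1 Gd Xd t0 (prufer_splits pB qB t0)).
Qed.
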